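(* Let $G,H,K$ be finite groups, $X'\le X\le G\times H$ and $Y'\le Y\le H\times K$ subgroups, $U$ a finite left $X'$-set and $V$ a finite left $Y'$-set. Then one has an isomorphism of $X*Y$-sets $$\mathrm{Ind}_{X'}^X(U)\overset{X,Y}{\otimes}\mathrm{Ind}_{Y'}^Y(V)\;\cong\;\coprod_{(x,y)}\mathrm{Ind}_{{}^xX'*{}^yY'}^{X*Y}\Bigl({}^xU\overset{{}^xX',{}^yY'}{\otimes}{}^yV\Bigr),$$ where $(x,y)$ runs through a set of representatives of the $(X\times_HY,\,X'\times Y')$-double cosets of $X\times Y$. The isomorphism is induced by the maps $u\otimes v\mapsto(x\otimes u)\otimes(y\otimes v)$ from ${}^xU\overset{{}^xX',{}^yY'}{\otimes}{}^yV$ to $\mathrm{Ind}_{X'}^X(U)\overset{X,Y}{\otimes}\mathrm{Ind}_{Y'}^Y(V)$. It is natural in $U$ and $V$, providing a natural isomorphism of functors from the product of the categories of finite left $X'$-sets and finite left $Y'$-sets to the category of finite left $X*Y$-sets.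
   Context: **Bisets and tensor products.** For finite groups $G,H,K$, a $(G,H)$-biset is a finite set with commuting left $G$-action and right $H$-action; it is identified with a left $G\times H$-set via $(g,h)u=guh^{-1}$. For a $(G,H)$-biset $U$ and an $(H,K)$-biset $V$, $U\otimes_HV$ is the set of $H$-orbits of $U\times V$ under $h\cdot(u,v)=(uh^{-1},hv)$; the orbit of $(u,v)$ is denoted $u\otimes v$, and $U\otimes_HV$ is a $(G,K)$-biset via $g(u\otimes v)k=(gu)\otimes(vk)$. (Taking $K=1$, $V$ may be a left $H$-set.) **Subgroups of direct products.** For $X\le G\times H$, set $k_1(X)=\{g\in G\mid(g,1)\in X\}$ and $k_2(X)=\{h\in H\mid(1,h)\in X\}$; similarly for $Y\le H\times K$. For $X\le G\times H$ and $Y\le H\times K$ set $$X*Y=\{(g,k)\in G\times K\mid\exists h\in H:(g,h)\in X,\ (h,k)\in Y\}\le G\times K,$$ $k(X,Y)=k_2(X)\cap k_1(Y)\le H$, and $X\times_HY=\{((g,h),(\tilde h,k))\in X\times Y\mid h=\tilde h\}\le X\times Y$. **Extended tensor product.** Let $U$ be a finite left $X$-set and $V$ a finite left $Y$-set. By restriction, $U$ is a $(k_1(X),k(X,Y))$-biset via $g\cdot u\cdot h=(g,h^{-1})u$, and $V$ is a $(k(X,Y),k_2(Y))$-biset via $h\cdot v\cdot k=(h,k^{-1})v$. On the set $U\otimes_{k(X,Y)}V$ the group $X*Y$ acts by $(g,k)(u\otimes v)=((g,h)u)\otimes((h,k)v)$, where $h\in H$ is any element with $(g,h)\in X$ and $(h,k)\in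 Y$ (this is well defined and independent of $h$). The resulting left $X*Y$-set is denoted $U\overset{X,Y}{\otimes}V$. **Conjugation and induction.** For $x\in X$, ${}^xX'=xX'x^{-1}$ and ${}^xU$ is the set $U$ with the left ${}^xX'$-action obtained via the conjugation map $c_{x^{-1}}\colon{}^xX'\to X'$, $z\mapsto x^{-1}zx$; similarly for $Y'$, $y\in Y$, $V$. Induction is $\mathrm{Ind}_{X'}^X(U)=X\otimes_{X'}U$, where $X$ is an $(X,X')$-biset by multiplication. *)

(* Defs.v *)
From mathcomp Require Import all_boot all_fingroup.

Set Implicit Arguments.
Unset Strict Implicit.
Unset Printing Implicit Defensive.

Import GroupScope.

Record category := Category {
  obj :> Type;
  hom : obj -> obj -> Type;
  cid : forall a, hom a a;
  ccomp : forall a b c, hom b c -> hom a b -> hom a c;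
  ccomp1f : forall a b (f : hom a b), ccomp (cid b) f = f;
  ccompf1 : forall a b (f : hom a b), ccomp f (cid a) = f;
  ccompA : forall a b c d (h : hom c d) (g : hom b c) (f : hom a b),
    ccomp h (ccomp g f) = ccomp (ccomp h g) f }.

Arguments hom {_} _ _.
Arguments cid {_} _.
Arguments ccomp {_ _ _ _} _ _.

Definition is_iso (C : category) (a b : C) (f : hom a b) : Prop :=
  exists g : hom b a, ccomp g f = cid a /\ ccomp f g = cid b.

Record functor (C D : category) := Functor {
  fobj :> C -> D;
  fmap : forall a b : C, hom a b -> hom (fobj a) (fobj b);
  fmap1 : forall a : C, fmap (cid a) = cid (fobj a);
  fmapM : forall (a b c : C) (g : hom b c) (f : hom a b),
    fmap (ccomp g f) = ccomp (fmap g) (fmap f) }.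

Arguments fmap {C D} _ {a b} _.

Record nat_trans (C D : category) (F G : functor C D) := NatTrans {
  component :> forall a : C, hom (F a) (G a);
  naturality : forall (a b : C) (f : hom a b),
    ccomp (component b) (fmap F f) = ccomp (fmap G f) (component a) }.

Definition is_nat_iso (C D : category) (F G : functor C D)
    (theta : nat_trans F G) : Prop :=
  forall a : C, is_iso (theta a).

Section Composition.
Variables (C D E : category) (G : functor D E) (F : functor C D).

Let fcomp_map (a b : C) (f : hom a b) : hom (G (F a)) (G (F b)) :=
  fmap G (fmap F f).

Lemma fcomp_map1 (a : C) : fcomp_map (cid a) = cid (G (F a)).
Proof. by rewrite /fcomp_map !fmap1. Qed.

Lemma fcomp_mapM (a b c : C) (g : hom b c) (f : hom a b) :
  fcomp_map (ccomp g f) = ccomp (fcomp_map g) (fcomp_map f).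
Proof. by rewrite /fcomp_map !fmapM. Qed.

Definition fcomp : functor C E := Functor fcomp_map1 fcomp_mapM.

End Composition.

Section Product.
Variables (C D : category).

Definition prod_hom (a b : C * D) : Type := hom a.1 b.1 * hom a.2 b.2.
Definition prod_id (a : C * D) : prod_hom a a := (cid a.1, cid a.2).
Definition prod_comp (a b c : C * D) (g : prod_hom b c) (f : prod_hom a b) :
  prod_hom a c := (ccomp g.1 f.1, ccomp g.2 f.2).

Lemma prod_comp1f a b (f : prod_hom a b) : prod_comp (prod_id b) f = f.
Proof. by case: f => f1 f2; rewrite /prod_comp !ccomp1f. Qed.

Lemma prod_compf1 a b (f : prod_hom a b) : prod_comp f (prod_id a) = f.
Proof. by case: f => f1 f2; rewrite /prod_comp !ccompf1. Qed.

Lemma prod_compA a b c d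
    (h : prod_hom c d) (g : prod_hom b c) (f : prod_hom a b) :
  prod_comp h (prod_comp g f) = prod_comp (prod_comp h g) f.
Proof. by rewrite /prod_comp /= !ccompA. Qed.

Definition prod_cat : category := Category prod_comp1f prod_compf1 prod_compA.

End Product.

Section ProductFunctor.
Variables (C C' D D' : category) (F : functor C D) (G : functor C' D').

Let fprod_obj (a : prod_cat C C') : prod_cat D D' := (F a.1, G a.2).
Let fprod_map (a b : prod_cat C C') (f : hom a b) :
  hom (fprod_obj a) (fprod_obj b) := (fmap F f.1, fmap G f.2).

Lemma fprod_map1 (a : prod_cat C C') : fprod_map (cid a) = cid (fprod_obj a).
Proof. by rewrite /fprod_map /= !fmap1. Qed.

Lemma fprod_mapM (a b c : prod_cat C C') (g : hom b c) (f : hom a b) :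
  fprod_map (ccomp g f) = ccomp (fprod_map g) (fprod_map f).
Proof. by rewrite /fprod_map /= !fmapM. Qed.

Definition fprod : functor (prod_cat C C') (prod_cat D D') :=
  Functor fprod_map1 fprod_mapM.

End ProductFunctor.

(* Finite left A-sets, for a subgroup A of the ambient group aT. As for       *)
(* MathComp's (right) actions, the action function is total, but it is only   *)
(* meaningful on A.                                                           *)
Record lset (aT : finGroupType) (A : {group aT}) := LSet {
  lset_sort :> finType;
  lact : aT -> lset_sort -> lset_sort;
  lact1 : forall u, lact 1 u = u;
  lactM : {in A &, forall a b, forall u,
    lact (a * b) u = lact a (lact b u)} }.

Section Homs.
Variables (aT : finGroupType) (A : {group aT}).

Definition equivariant (S T : lset A) (f : S -> T) : bool :=
  [forall a in A, forall s, f (lact a s) == lact a (f s)].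

Lemma equivariantP (S T : lset A) (f : S -> T) :
  reflect {in A, forall a, {morph f : s / lact a s}} (equivariant f).
Proof.
by apply: (iffP 'forall_in_forallP) => h a Aa s; apply/eqP/h.
Qed.

Record lhom (S T : lset A) := LHom {
  lhom_fun :> {ffun S -> T};
  lhom_equivariant : equivariant lhom_fun }.

Lemma mk_lhom_subproof (S T : lset A) (f : S -> T) :
  {in A, forall a, {morph f : s / lact a s}} -> equivariant [ffun s => f s].
Proof. by move=> fE; apply/equivariantP => a Aa s; rewrite !ffunE fE. Qed.

Definition mk_lhom (S T : lset A) (f : S -> T)
    (fE : {in A, forall a, {morph f : s / lact a s}}) : lhom S T :=
  LHom (mk_lhom_subproof fE).

Lemma mk_lhomE (S T : lset A) (f : S -> T) fE s :
  @mk_lhom S T f fE s = f s.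
Proof. by rewrite ffunE. Qed.

Lemma lhomP (S T : lset A) (f g : lhom S T) : f =1 g -> f = g.
Proof.
case: f g => f fE [g gE] /= /ffunP fg; case: g / fg gE => gE.
by rewrite (bool_irrelevance fE gE).
Qed.

Lemma lhomJ (S T : lset A) (f : lhom S T) a s :
  a \in A -> f (lact a s) = lact a (f s).
Proof. by move=> Aa; have /equivariantP -> := lhom_equivariant f. Qed.

Lemma id_equivariant (S : lset A) :
  {in A, forall a, {morph @id S : s / lact a s}}.
Proof. by []. Qed.

Definition lhom_id (S : lset A) : lhom S S := mk_lhom (@id_equivariant S).

Lemma lhom_idE (S : lset A) s : lhom_id S s = s.
Proof. exact: mk_lhomE. Qed.

Lemma comp_equivariant (S T V : lset A) (g : lhom T V) (f : lhom S T) :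
  {in A, forall a, {morph g \o f : s / lact a s}}.
Proof. by move=> a Aa s /=; rewrite !lhomJ. Qed.

Definition lhom_comp (S T V : lset A) (g : lhom T V) (f : lhom S T) :
  lhom S V := mk_lhom (comp_equivariant g f).

Lemma lhom_compE (S T V : lset A) (g : lhom T V) (f : lhom S T) s :
  lhom_comp g f s = g (f s).
Proof. exact: mk_lhomE. Qed.

Lemma lhom_comp1f (S T : lset A) (f : lhom S T) : lhom_comp (lhom_id T) f = f.
Proof. by apply: lhomP => s; rewrite lhom_compE lhom_idE. Qed.

Lemma lhom_compf1 (S T : lset A) (f : lhom S T) : lhom_comp f (lhom_id S) = f.
Proof. by apply: lhomP => s; rewrite lhom_compE lhom_idE. Qed.

Lemma lhom_compA (S T V W : lset A)
    (h : lhom V W) (g : lhom T V) (f : lhom S T) :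
  lhom_comp h (lhom_comp g f) = lhom_comp (lhom_comp h g) f.
Proof. by apply: lhomP => s; rewrite !lhom_compE. Qed.

Definition lsets : category := Category lhom_comp1f lhom_compf1 lhom_compA.

Lemma lsets_idE (S : lsets) (s : (S : lset A)) : (cid S : lhom S S) s = s.
Proof. exact: lhom_idE. Qed.

Lemma lsets_compE (S T V : lsets) (g : hom T V) (f : hom S T)
    (s : (S : lset A)) :
  (ccomp g f : lhom S V) s = (g : lhom T V) ((f : lhom S T) s).
Proof. exact: lhom_compE. Qed.

Definition lapp (S T : lsets) (f : hom S T) (s : (S : lset A)) : (T : lset A) :=
  (f : lhom S T) s.

Section Coproduct.
Variables (I : finType) (S : I -> lset A).

Let T : finType := {i : I & S i}.
Let coprod_act (a : aT) (s : T) : T :=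
  Tagged (fun i => S i) (lact a (tagged s)).

Lemma coprod_act1 s : coprod_act 1 s = s.
Proof. by case: s => i s; rewrite /coprod_act lact1. Qed.

Lemma coprod_actM : {in A &, forall a b, forall s,
  coprod_act (a * b) s = coprod_act a (coprod_act b s)}.
Proof. by move=> a b Aa Ab [i s]; rewrite /coprod_act lactM. Qed.

Definition lcoprod : lset A := LSet coprod_act1 coprod_actM.

End Coproduct.

Section CoproductFunctor.
Variables (C : category) (I : finType) (F : I -> functor C lsets).

Definition coprod_fun (a b : C) (f : hom a b)
    (s : lcoprod (fun i => F i a)) : lcoprod (fun i => F i b) :=
  Tagged (fun i => F i b) ((fmap (F (tag s)) f : lhom _ _) (tagged s)).

Lemma coprod_fun_equivariant (a b : C) (f : hom a b) :
  {in A, forall x, {morph coprod_fun f : s / lact x s}}.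
Proof. by move=> x Ax s; rewrite /coprod_fun /= lhomJ. Qed.

Lemma coprod_fun1 (a : C) :
  mk_lhom (coprod_fun_equivariant (cid a)) = lhom_id (lcoprod (fun i => F i a)).
Proof.
apply: lhomP => -[i s].
by rewrite mk_lhomE lhom_idE /coprod_fun fmap1 lsets_idE.
Qed.

Lemma coprod_funM (a b c : C) (g : hom b c) (f : hom a b) :
  mk_lhom (coprod_fun_equivariant (ccomp g f)) =
  lhom_comp (mk_lhom (coprod_fun_equivariant g))
            (mk_lhom (coprod_fun_equivariant f)).
Proof.
apply: lhomP => -[i s].
by rewrite lhom_compE !mk_lhomE /coprod_fun fmapM lsets_compE.
Qed.

Definition lcoprod_functor : functor C lsets :=
  @Functor C lsets (fun c => lcoprod (fun i => F i c)) _
    coprod_fun1 coprod_funM.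

End CoproductFunctor.

End Homs.

Arguments lsets {aT} A.

Record biset (aT bT : finGroupType) (A : {group aT}) (B : {group bT}) := Biset {
  biset_sort :> finType;
  bactl : aT -> biset_sort -> biset_sort;
  bactr : biset_sort -> bT -> biset_sort;
  bactl1 : forall u, bactl 1 u = u;
  bactlM : {in A &, forall a b, forall u,
    bactl (a * b) u = bactl a (bactl b u)};
  bactr1 : forall u, bactr u 1 = u;
  bactrM : {in B &, forall a b, forall u,
    bactr u (a * b) = bactr (bactr u a) b};
  bactC : {in A & B, forall a b, forall u,
    bactr (bactl a u) b = bactl a (bactr u b)} }.

Definition biset_lset (aT bT : finGroupType) (A : {group aT}) (B : {group bT})
  (U : biset A B) : lset A := LSet (@bactl1 _ _ _ _ U) (@bactlM _ _ _ _ U).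

Section Tensor.
Variables (aT hT : finGroupType) (A : {group aT}) (H : {group hT}).
Variables (U : biset A H) (V : lset H).

Definition tensor_orbit (p : U * V) : {set U * V} :=
  [set (bactr p.1 h^-1, lact h p.2) | h in H].

Definition tensor : finType :=
  {O : {set U * V} | O \in [set tensor_orbit p | p : U * V]}.

Lemma tensor_orbit_in p : tensor_orbit p \in [set tensor_orbit p | p : U * V].
Proof. exact: imset_f. Qed.

Definition tens (u : U) (v : V) : tensor :=
  exist _ (tensor_orbit (u, v)) (tensor_orbit_in (u, v)).

Lemma tensor_ex (t : tensor) : exists p, tens p.1 p.2 == t.
Proof.
have /imsetP[[u v] _ tO] := valP t.
by exists (u, v); apply/eqP/val_inj.
Qed.

Definition tensor_repr (t : tensor) : U * V := xchoose (tensor_ex t).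

Lemma tensor_reprK t : tens (tensor_repr t).1 (tensor_repr t).2 = t.
Proof. exact/eqP/(xchooseP (tensor_ex t)). Qed.

Lemma tens_eqP u v u' v' :
  reflect (exists2 h, h \in H & u' = bactr u h^-1 /\ v' = lact h v)
          (tens u v == tens u' v').
Proof.
apply: (iffP eqP) => [[/setP/(_ (u', v'))] | [h Hh [-> ->]]].
  have -> : (u', v') \in tensor_orbit (u', v').
    by apply/imsetP; exists 1; rewrite ?group1 //= invg1 bactr1 lact1.
  by case/imsetP=> h Hh [-> ->]; exists h.
apply/val_inj/setP=> -[a b] /=; apply/imsetP/imsetP=> -[k Hk [-> ->]] /=.
- exists (k * h^-1); first by rewrite groupM ?groupV.
  by rewrite -bactrM ?groupV ?groupM ?groupV // -lactM ?groupM ?groupV //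
             -invMg mulgKV.
- exists (k * h); first exact: groupM.
  by rewrite invMg bactrM ?groupV // lactM.
Qed.

Lemma tens_bal u v h : h \in H -> tens (bactr u h) v = tens u (lact h v).
Proof.
move=> Hh; apply/eqP/tens_eqP; exists h => //.
by rewrite -bactrM ?groupV // mulgV bactr1.
Qed.

(* The map u (x) v |-> f u v; only meaningful when f is balanced over H. *)
Definition tensor_lift (T : Type) (f : U -> V -> T) (t : tensor) : T :=
  f (tensor_repr t).1 (tensor_repr t).2.

Lemma tensor_liftE (T : Type) (f : U -> V -> T) u v :
  (forall h u v, h \in H -> f (bactr u h) v = f u (lact h v)) ->
  tensor_lift f (tens u v) = f u v.
Proof.
move=> fbal; rewrite /tensor_lift.
have /eqP := tensor_reprK (tens u v); case: (tensor_repr _) => u' v' /=.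
case/tens_eqP=> h Hh [-> ->]; rewrite -fbal // -bactrM ?groupV //.
by rewrite mulVg bactr1.
Qed.

Lemma tensor_ind (P : tensor -> Prop) : (forall u v, P (tens u v)) -> forall t, P t.
Proof. by move=> Pt t; rewrite -(tensor_reprK t). Qed.

Definition tensor_act (a : aT) : tensor -> tensor :=
  tensor_lift (fun u v => tens (bactl a u) v).

Lemma tensor_actE a u v : a \in A -> tensor_act a (tens u v) = tens (bactl a u) v.
Proof.
by move=> Aa; apply: tensor_liftE => h w z Hh; rewrite -bactC // tens_bal.
Qed.

Lemma tensor_act1 t : tensor_act 1 t = t.
Proof. by elim/tensor_ind: t => u v; rewrite tensor_actE // bactl1. Qed.

Lemma tensor_actM : {in A &, forall a b, forall t,
  tensor_act (a * b) t = tensor_act a (tensor_act b t)}.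
Proof.
move=> a b Aa Ab; elim/tensor_ind=> u v.
by rewrite !tensor_actE ?groupM // bactlM.
Qed.

Definition ltensor : lset A := LSet tensor_act1 tensor_actM.

End Tensor.

Lemma ltensorE (aT hT : finGroupType) (A : {group aT}) (H : {group hT})
    (U : biset A H) (V : lset H) a (u : U) (v : V) : a \in A ->
  @lact _ _ (ltensor U V) a (tens u v) = tens (bactl a u) v.
Proof. exact: tensor_actE. Qed.

Section Induction.
Variables (aT : finGroupType) (A B : {group aT}) (sBA : B \subset A).

Let mul_actl (a : aT) (z : subg_of A) : subg_of A := subg A a * z.
Let mul_actr (z : subg_of A) (b : aT) : subg_of A := z * subg A b.

Lemma mul_actl1 z : mul_actl 1 z = z.
Proof. by rewrite /mul_actl morph1 mul1g. Qed.

Lemma mul_actlM : {in A &, forall a b, forall z,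
  mul_actl (a * b) z = mul_actl a (mul_actl b z)}.
Proof. by move=> a b Aa Ab z; rewrite /mul_actl morphM // mulgA. Qed.

Lemma mul_actr1 z : mul_actr z 1 = z.
Proof. by rewrite /mul_actr morph1 mulg1. Qed.

Lemma mul_actrM : {in B &, forall a b, forall z,
  mul_actr z (a * b) = mul_actr (mul_actr z a) b}.
Proof.
by move=> a b Ba Bb z; rewrite /mul_actr morphM ?mulgA // (subsetP sBA).
Qed.

Lemma mul_actC : {in A & B, forall a b, forall z,
  mul_actr (mul_actl a z) b = mul_actl a (mul_actr z b)}.
Proof. by move=> a b _ _ z; rewrite /mul_actr /mul_actl mulgA. Qed.

(* A as an (A, B)-biset. *)
Definition mul_biset : biset A B :=
  Biset mul_actl1 mul_actlM mul_actr1 mul_actrM mul_actC.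

Definition ind (U : lset B) : lset A := ltensor mul_biset U.

Definition ind_tens (U : lset B) (a : aT) (u : U) : ind U :=
  tens (subg A a : mul_biset) u.

(* a (x) u |-> a (x) f u *)
Definition ind_fun (U V : lset B) (f : lhom U V) : ind U -> ind V :=
  tensor_lift (fun (z : mul_biset) u => @tens _ _ _ _ mul_biset V z (f u)).

Lemma ind_funE (U V : lset B) (f : lhom U V) (z : mul_biset) (u : U) :
  ind_fun f (tens z u) = @tens _ _ _ _ mul_biset V z (f u).
Proof.
by apply: tensor_liftE => h {}z {}u Bh; rewrite tens_bal // lhomJ.
Qed.

Lemma ind_fun_equivariant (U V : lset B) (f : lhom U V) :
  {in A, forall a, {morph ind_fun f : t / lact a t}}.
Proof.
move=> a Aa; elim/tensor_ind=> z u.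
by rewrite ltensorE // !ind_funE ltensorE.
Qed.

Lemma ind_fun1 (U : lset B) :
  mk_lhom (ind_fun_equivariant (lhom_id U)) = lhom_id (ind U).
Proof.
apply: lhomP; elim/tensor_ind=> z u.
by rewrite mk_lhomE lhom_idE ind_funE lhom_idE.
Qed.

Lemma ind_funM (U V W : lset B) (g : lhom V W) (f : lhom U V) :
  mk_lhom (ind_fun_equivariant (lhom_comp g f)) =
  lhom_comp (mk_lhom (ind_fun_equivariant g)) (mk_lhom (ind_fun_equivariant f)).
Proof.
apply: lhomP; elim/tensor_ind=> z u.
by rewrite [RHS]lhom_compE 3!mk_lhomE !ind_funE lhom_compE.
Qed.

Definition ind_functor : functor (lsets B) (lsets A) :=
  @Functor (lsets B) (lsets A) ind _ ind_fun1 ind_funM.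

End Induction.

Section Conjugation.
Variables (aT : finGroupType) (A : {group aT}) (x : aT).

Lemma conj_act1 (U : lset A) (u : U) : lact (1 ^ x) u = u.
Proof. by rewrite conj1g lact1. Qed.

Lemma conj_actM (U : lset A) : {in (A :^ x^-1)%G &, forall a b, forall u : U,
  lact ((a * b) ^ x) u = lact (a ^ x) (lact (b ^ x) u)}.
Proof.
by move=> a b; rewrite !mem_conjgV => Aa Ab u; rewrite conjMg lactM.
Qed.

(* In MathComp z ^ x = x^-1 * z * x, so A :^ x^-1 is x A x^-1. *)
Definition lconj (U : lset A) : lset (A :^ x^-1)%G :=
  @LSet _ (A :^ x^-1)%G U (fun z u => lact (z ^ x) u)
    (@conj_act1 U) (@conj_actM U).

Lemma lconj_equivariant (U V : lset A) (f : lhom U V) :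
  {in (A :^ x^-1)%G,
    forall z, {morph (f : lconj U -> lconj V) : u / lact z u}}.
Proof. by move=> z; rewrite mem_conjgV => Az u /=; rewrite lhomJ. Qed.

Lemma lconj_fun1 (U : lset A) :
  mk_lhom (lconj_equivariant (lhom_id U)) = lhom_id (lconj U).
Proof. by apply: lhomP => u; rewrite mk_lhomE !lhom_idE. Qed.

Lemma lconj_funM (U V W : lset A) (g : lhom V W) (f : lhom U V) :
  mk_lhom (lconj_equivariant (lhom_comp g f)) =
  lhom_comp (mk_lhom (lconj_equivariant g)) (mk_lhom (lconj_equivariant f)).
Proof.
by apply: lhomP => u; rewrite [RHS]lhom_compE 3!mk_lhomE lhom_compE.
Qed.

Definition conj_functor : functor (lsets A) (lsets (A :^ x^-1)%G) :=
  @Functor (lsets A) (lsets (A :^ x^-1)%G) lconj _ lconj_fun1 lconj_funM.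

End Conjugation.

Section DirectProducts.
Variables (gT hT : finGroupType).
Implicit Types (X : {group gT * hT}).

Lemma pairM (a c : gT) (b d : hT) : (a, b) * (c, d) = (a * c, b * d).
Proof. by []. Qed.

Lemma pairV (a : gT) (b : hT) : (a, b)^-1 = (a^-1, b^-1).
Proof. by []. Qed.

Lemma pair1V X h : ((1, h^-1) \in X) = ((1, h) \in X).
Proof. by rewrite -groupV pairV invg1 invgK. Qed.

Lemma pairV1 X g : ((g^-1, 1) \in X) = ((g, 1) \in X).
Proof. by rewrite -groupV pairV invg1 invgK. Qed.

Definition k1 X : {set gT} := [set g | (g, 1) \in X].
Definition k2 X : {set hT} := [set h | (1, h) \in X].

Lemma k1_group_set X : group_set (k1 X).
Proof.
apply/group_setP; split=> [|a b]; rewrite !inE ?group1 // => Xa Xb.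
by have := groupM Xa Xb; rewrite pairM mulg1.
Qed.
Canonical k1_group X := Group (k1_group_set X).

Lemma k2_group_set X : group_set (k2 X).
Proof.
apply/group_setP; split=> [|a b]; rewrite !inE ?group1 // => Xa Xb.
by have := groupM Xa Xb; rewrite pairM mulg1.
Qed.
Canonical k2_group X := Group (k2_group_set X).

End DirectProducts.

Section ExtendedTensor.
Variables (gT hT kT : finGroupType).
Implicit Types (X : {group gT * hT}) (Y : {group hT * kT}).

Definition linked X Y (p : gT * kT) (h : hT) : bool :=
  ((p.1, h) \in X) && ((h, p.2) \in Y).

Definition star X Y : {set gT * kT} := [set p | [exists h, linked X Y p h]].

Lemma linked1 X Y : linked X Y 1 1.
Proof. by rewrite /linked !group1. Qed.

Lemma linkedM X Y p q h h' :
  linked X Y p h -> linked X Y q h' -> linked X Y (p * q) (h * h').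
Proof.
by case/andP=> Xp Yp /andP[Xq Yq]; apply/andP; split;
  [exact: (groupM Xp Xq) | exact: (groupM Yp Yq)].
Qed.

Lemma star_group_set X Y : group_set (star X Y).
Proof.
apply/group_setP; split=> [|p q]; rewrite !inE.
  by apply/existsP; exists 1; exact: linked1.
case/existsP=> h ph /existsP[h' qh'].
by apply/existsP; exists (h * h'); exact: linkedM.
Qed.
Canonical star_group X Y := Group (star_group_set X Y).

Lemma starS X X' Y Y' :
  X' \subset X -> Y' \subset Y -> star X' Y' \subset star X Y.
Proof.
move=> /subsetP sX /subsetP sY; apply/subsetP=> p; rewrite !inE.
case/existsP=> h /andP[Xp Yp]; apply/existsP; exists h.
by rewrite /linked sX ?sY.
Qed.

Definition kk X Y : {set hT} := k2 X :&: k1 Y.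
Canonical kk_group X Y := [group of kk X Y].

Definition fibre_prod X Y : {set (gT * hT) * (hT * kT)} :=
  [set p in setX X Y | p.1.2 == p.2.1].

Lemma fibre_prod_group_set X Y : group_set (fibre_prod X Y).
Proof.
apply/group_setP; split=> [|p q]; rewrite !inE ?group1 //=.
case/andP=> /andP[Xp Yp] /eqP e /andP[/andP[Xq Yq] /eqP e'].
by rewrite !groupM //=; apply/eqP; congr (_ * _).
Qed.
Canonical fibre_prod_group X Y := Group (fibre_prod_group_set X Y).

Section Carrier.
Variables (X : {group gT * hT}) (Y : {group hT * kT}).

Definition left_biset (U : lset X) : biset (k1_group X) (kk_group X Y).
Proof.
exists U (fun g u => lact (g, 1) u) (fun u h => lact (1, h^-1) u).
- exact: lact1.
- move=> a b; rewrite !inE => Xa Xb u; rewrite -lactM //.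
  by rewrite pairM mulg1.
- by move=> u; rewrite invg1 lact1.
- move=> a b; rewrite !inE => /andP[Xa _] /andP[Xb _] u.
  by rewrite -lactM ?pair1V // pairM mulg1 invMg.
- move=> a b; rewrite !inE => Xa /andP[Xb _] u.
  by rewrite -!lactM ?pair1V // !pairM !mulg1 !mul1g.
Defined.

Definition right_biset (V : lset Y) : biset (kk_group X Y) (k2_group Y).
Proof.
exists V (fun h v => lact (h, 1) v) (fun v k => lact (1, k^-1) v).
- exact: lact1.
- move=> a b; rewrite !inE => /andP[_ Ya] /andP[_ Yb] v; rewrite -lactM //.
  by rewrite pairM mulg1.
- by move=> v; rewrite invg1 lact1.
- move=> a b; rewrite !inE => Ya Yb v.
  by rewrite -lactM ?pair1V // pairM mulg1 invMg.
- move=> a b; rewrite !inE => /andP[_ Ya] Yb v.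
  by rewrite -!lactM ?pair1V // !pairM !mulg1 !mul1g.
Defined.

Definition ext_carrier (U : lset X) (V : lset Y) : finType :=
  tensor (left_biset U) (biset_lset (right_biset V)).

Definition ext_tens (U : lset X) (V : lset Y) (u : U) (v : V) :
  ext_carrier U V := tens (u : left_biset U) (v : biset_lset (right_biset V)).

Definition ext_lift (U : lset X) (V : lset Y) (T : Type) (f : U -> V -> T) :
    ext_carrier U V -> T :=
  @tensor_lift _ _ _ _ (left_biset U) (biset_lset (right_biset V)) T f.

Lemma ext_liftE (U : lset X) (V : lset Y) (T : Type) (f : U -> V -> T)
    (u : U) (v : V) :
  (forall h u v, h \in kk X Y -> f (lact (1, h^-1) u) v = f u (lact (h, 1) v)) ->
  ext_lift f (ext_tens u v) = f u v.
Proof.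
move=> fbal.
exact: (@tensor_liftE _ _ _ _ (left_biset U) (biset_lset (right_biset V))).
Qed.

Definition link (p : gT * kT) : hT := odflt 1 [pick h | linked X Y p h].

Definition ext_act (U : lset X) (V : lset Y) (p : gT * kT) :
    ext_carrier U V -> ext_carrier U V :=
  ext_lift (fun (u : U) (v : V) =>
    ext_tens (lact (p.1, link p) u) (lact (link p, p.2) v)).

Lemma ext_tens_ind (U : lset X) (V : lset Y) (P : ext_carrier U V -> Prop) :
  (forall (u : U) (v : V), P (ext_tens u v)) -> forall t, P t.
Proof. exact: (@tensor_ind _ _ _ _ (left_biset U) (biset_lset (right_biset V))). Qed.

Lemma linkP p : p \in star X Y -> linked X Y p (link p).
Proof.
rewrite inE /link; case: pickP => [h ph // | np /existsP[h]].
by rewrite np.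
Qed.

Lemma ext_tens_bal (U : lset X) (V : lset Y) (u : U) (v : V) h : h \in kk X Y ->
  ext_tens (lact (1, h) u) v = ext_tens u (lact (h^-1, 1) v).
Proof.
move=> kh; have := @tens_bal _ _ _ _ (left_biset U)
  (biset_lset (right_biset V)) u v h^-1.
by rewrite groupV => /(_ kh); rewrite /= invgK.
Qed.

Lemma ext_act_bal (U : lset X) (V : lset Y) p h : linked X Y p h ->
  forall h' (u : U) (v : V), h' \in kk X Y ->
  ext_tens (lact (p.1, h) (lact (1, h'^-1) u)) (lact (h, p.2) v) =
  ext_tens (lact (p.1, h) u) (lact (h, p.2) (lact (h', 1) v)).
Proof.
case: p => g k /andP[/= Xp Yp] h' u v; rewrite !inE => /andP[Xh' Yh'].
have Vh : (1, h'^-1) \in X by rewrite pair1V.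
set c := h' ^ h^-1.
have Xc : (1, c) \in X.
  have := groupJ Xh' (groupVr Xp).
  by rewrite /conjg !pairV !pairM mul1g mulVg.
have Yc : (c, 1) \in Y.
  have := groupJ Yh' (groupVr Yp).
  by rewrite /conjg !pairV !pairM mul1g mulVg.
have XcV : (1, c^-1) \in X by rewrite pair1V.
have kc : c^-1 \in kk X Y by rewrite groupV !inE Xc.
have -> : lact (g, h) (lact (1, h'^-1) u) = lact (1, c^-1) (lact (g, h) u).
  rewrite -!lactM //; congr (lact _ u).
  rewrite !pairM mulg1 mul1g; congr (_, _).
  by rewrite /c -conjVg /conjg invgK -!mulgA mulVg mulg1.
rewrite ext_tens_bal // invgK; congr ext_tens.
rewrite -!lactM //; congr (lact _ v).
rewrite !pairM mulg1 mul1g; congr (_, _).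
by rewrite /c /conjg invgK -!mulgA mulVg mulg1.
Qed.

(* The action does not depend on the choice of h. *)
Lemma ext_actE (U : lset X) (V : lset Y) p h (u : U) (v : V) : linked X Y p h ->
  ext_act p (ext_tens u v) = ext_tens (lact (p.1, h) u) (lact (h, p.2) v).
Proof.
move=> ph; have pl : linked X Y p (link p).
  by apply: linkP; rewrite inE; apply/existsP; exists h.
rewrite /ext_act ext_liftE; last exact: ext_act_bal.
case: p ph pl => g k; move: (link _) => l /andP[/= Xh Yh] /andP[/= Xl Yl].
set d := l * h^-1.
have Xd : (1, d) \in X.
  have := groupM Xl (groupVr Xh).
  by rewrite pairV pairM mulgV.
have Yd : (d, 1) \in Y.
  have := groupM Yl (groupVr Yh).
  by rewrite pairV pairM mulgV.
have YdV : (d^-1, 1) \in Y by rewrite pairV1.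
have -> : lact (g, l) u = lact (1, d) (lact (g, h) u).
  rewrite -lactM //; congr (lact _ u).
  by rewrite pairM mul1g mulgKV.
rewrite ext_tens_bal ?inE ?Xd //; congr ext_tens.
rewrite -lactM //; congr (lact _ v).
by rewrite pairM mul1g invMg invgK mulgKV.
Qed.

Lemma ext_act1 (U : lset X) (V : lset Y) (t : ext_carrier U V) :
  ext_act 1 t = t.
Proof.
elim/ext_tens_ind: t => u v.
by rewrite (ext_actE _ _ (linked1 X Y)) !lact1.
Qed.

Lemma ext_actM (U : lset X) (V : lset Y) :
  {in star_group X Y &, forall p q, forall t : ext_carrier U V,
     ext_act (p * q) t = ext_act p (ext_act q t)}.
Proof.
move=> p q /linkP pl /linkP ql; elim/ext_tens_ind=> u v.
rewrite (ext_actE _ _ (linkedM pl ql)) (ext_actE _ _ ql) (ext_actE _ _ pl).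
case: p q pl ql => [g k] [g' k'] /andP[Xp Yp] /andP[Xq Yq].
by rewrite -(lactM Xp Xq) -(lactM Yp Yq).
Qed.

Definition ext (U : lset X) (V : lset Y) : lset (star_group X Y) :=
  LSet (@ext_act1 U V) (@ext_actM U V).

(* u (x) v |-> f u (x) g v *)
Definition ext_fun (U U' : lset X) (V V' : lset Y)
    (f : lhom U U') (g : lhom V V') : ext U V -> ext U' V' :=
  ext_lift (fun (u : U) (v : V) => ext_tens (f u) (g v)).

Lemma ext_funE (U U' : lset X) (V V' : lset Y)
    (f : lhom U U') (g : lhom V V') (u : U) (v : V) :
  ext_fun f g (ext_tens u v) = ext_tens (f u) (g v).
Proof.
apply: ext_liftE => h {}u {}v kh; have := kh; rewrite !inE => /andP[Xh Yh].
by rewrite /= !lhomJ // ?pair1V // ext_tens_bal ?groupV // invgK.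
Qed.

Lemma ext_fun_equivariant (U U' : lset X) (V V' : lset Y)
    (f : lhom U U') (g : lhom V V') :
  {in star_group X Y, forall p, {morph ext_fun f g : t / lact p t}}.
Proof.
move=> p /linkP pl; elim/ext_tens_ind=> u v; have /andP[Xp Yp] := pl.
by rewrite /= (ext_actE _ _ pl) !ext_funE (ext_actE _ _ pl) !lhomJ.
Qed.

Lemma ext_fun1 (U : lset X) (V : lset Y) :
  mk_lhom (ext_fun_equivariant (lhom_id U) (lhom_id V)) = lhom_id (ext U V).
Proof.
apply: lhomP; elim/ext_tens_ind=> u v.
by rewrite mk_lhomE lhom_idE ext_funE !lhom_idE.
Qed.

Lemma ext_funM (U U' U'' : lset X) (V V' V'' : lset Y)
    (g : lhom U' U'') (g' : lhom V' V'') (f : lhom U U') (f' : lhom V V') :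
  mk_lhom (ext_fun_equivariant (lhom_comp g f) (lhom_comp g' f')) =
  lhom_comp (mk_lhom (ext_fun_equivariant g g'))
            (mk_lhom (ext_fun_equivariant f f')).
Proof.
apply: lhomP; elim/ext_tens_ind=> u v.
by rewrite [RHS]lhom_compE 3!mk_lhomE !ext_funE !lhom_compE.
Qed.

Definition ext_functor :
    functor (prod_cat (lsets X) (lsets Y)) (lsets (star_group X Y)) :=
  @Functor (prod_cat (lsets X) (lsets Y)) (lsets (star_group X Y))
    (fun UV => ext UV.1 UV.2) _
    (fun UV => ext_fun1 UV.1 UV.2)
    (fun UV UV' UV'' g f => ext_funM g.1 g.2 f.1 f.2).

End Carrier.

End ExtendedTensor.

(* The (D, E)-double cosets D z E in A. *)
Definition dcosets (aT : finGroupType) (D E A : {set aT}) : {set {set aT}} :=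
  [set D * [set z] * E | z in A].

Section Mackey.
Variables (gT hT kT : finGroupType).
Variables (X X' : {group gT * hT}) (Y Y' : {group hT * kT}).
Variables (sX : X' \subset X) (sY : Y' \subset Y).

Definition lhs_functor :
    functor (prod_cat (lsets X') (lsets Y')) (lsets (star_group X Y)) :=
  fcomp (ext_functor X Y) (fprod (ind_functor sX) (ind_functor sY)).

Lemma lhs_functorE U V : lhs_functor (U, V) = ext (ind sX U) (ind sY V).
Proof. by []. Qed.

Definition dcoset_reprs (R : {set (gT * hT) * (hT * kT)}) : bool :=
  is_transversal R
    (dcosets (fibre_prod X Y) (setX X' Y') (setX X Y)) (setX X Y).

Lemma star_conj_sub x y : x \in X -> y \in Y ->
  star_group (X' :^ x^-1)%G (Y' :^ y^-1)%G \subset star_group X Y.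
Proof.
by move=> Xx Yy; apply: starS; rewrite /= sub_conjg invgK conjGid.
Qed.

Definition summand_functor x y (Xx : x \in X) (Yy : y \in Y) :
    functor (prod_cat (lsets X') (lsets Y')) (lsets (star_group X Y)) :=
  fcomp (ind_functor (star_conj_sub Xx Yy))
    (fcomp (ext_functor (X' :^ x^-1)%G (Y' :^ y^-1)%G)
      (fprod (conj_functor X' x) (conj_functor Y' y))).

(* The element 1 (x) (u (x) v) of the induced set, i.e. the image of u (x) v  *)
(* under the unit of induction; a morphism out of the induced set is          *)
(* determined by its values on these elements.                                *)
Definition summand_elt (U : lset X') (V : lset Y') x y
    (Xx : x \in X) (Yy : y \in Y) (u : U) (v : V) :
    (summand_functor Xx Yy (U, V) : lset _) :=
  @ind_tens _ _ _ (star_conj_sub Xx Yy) (ext (lconj x U) (lconj y V)) 1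
    (@ext_tens _ _ _ _ _ (lconj x U) (lconj y V) u v).

Variables (R : {set (gT * hT) * (hT * kT)}) (hR : dcoset_reprs R).

Lemma repr_mem1 (i : {p | p \in R}) : (val i).1 \in X.
Proof.
case: i => p Rp /=; case/and3P: hR => _ /subsetP/(_ p Rp).
by rewrite inE => /andP[].
Qed.

Lemma repr_mem2 (i : {p | p \in R}) : (val i).2 \in Y.
Proof.
case: i => p Rp /=; case/and3P: hR => _ /subsetP/(_ p Rp).
by rewrite inE => /andP[].
Qed.

Definition rhs_functor :
    functor (prod_cat (lsets X') (lsets Y')) (lsets (star_group X Y)) :=
  lcoprod_functor (fun i : {p | p \in R} =>
    summand_functor (repr_mem1 i) (repr_mem2 i)).

Definition rhs_elt (U : lset X') (V : lset Y') (i : {p | p \in R})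
    (u : U) (v : V) : (rhs_functor (U, V) : lset _) :=
  Tagged (fun i => summand_functor (repr_mem1 i) (repr_mem2 i) (U, V) : lset _)
    (summand_elt (repr_mem1 i) (repr_mem2 i) u v).

Lemma rhs_functorE U V : rhs_functor (U, V) = lcoprod (fun i : {p | p \in R} =>
  ind (star_conj_sub (repr_mem1 i) (repr_mem2 i))
      (ext (lconj (val i).1 U) (lconj (val i).2 V))).
Proof. by []. Qed.

End Mackey.

(* Main.v *)
Require Import Defs.
From mathcomp Require Import all_boot all_fingroup.

Set Implicit Arguments.
Unset Strict Implicit.
Unset Printing Implicit Defensive.

Import GroupScope.

(** This is a Mackey formula, and the isomorphism is forced by the universal
    properties of its source. For [x] in [X] and [y] in [Y] the rule
    [u (x) v |-> (x (x) u) (x) (y (x) v)] is balanced over [k(xX', yY')] and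
    equivariant for [xX' * yY'] ([summand_unit_bal],
    [summand_unit_equivariant]), because [x X' x^-1] acts on the subset
    [x (x) U] of the set induced from [U] as it acts on the conjugate of [U]
    ([ind_tens_conj]). By Frobenius reciprocity ([ind_lift]) it extends to the
    set induced to [X * Y], and the extensions for all the representatives are
    glued on the coproduct ([mackey_fun]).

    A morphism of finite left sets is invertible as soon as it is bijective
    ([bij_is_iso]). Every element of the target has the form
    [(a (x) u) (x) (b (x) v)] with [a] in [X] and [b] in [Y]. A double coset
    decomposition [a = (g, h) x p], [b = (h, k) y q], with [p] in [X'] and [q]
    in [Y'], rewrites it as [(g, k)] applied to
    [(x (x) p u) (x) (y (x) q v)], so the map is surjective
    ([mackey_fun_surj]). Conversely, unfolding the equality of two images in
    the extended tensor product and then in both induced sets yields elements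
    of [H], [X'] and [Y'] which show that the two representatives lie in the
    same double coset, hence coincide; the same elements then identify the two
    elements of the source ([mackey_eq]). Naturality holds because every functor
    involved acts on tensors factor by factor. *)

(** * Isomorphisms of left sets *)

Lemma bij_is_iso (aT : finGroupType) (A : {group aT}) (S T : lsets A)
    (f : hom S T) :
  injective (lapp f) -> (forall t, exists s, lapp f s = t) -> is_iso f.
Proof.
move=> f_inj f_surj.
have f_ex t : exists s, lapp f s == t by have [s <-] := f_surj t; exists s.
pose g t := xchoose (f_ex t).
have gK : cancel g (lapp f) by move=> t; apply/eqP/(xchooseP (f_ex t)).
have gE : {in A, forall a, {morph g : t / lact a t}}.
  move=> a Aa t; apply: f_inj; rewrite gK -{1}(gK t).
  by rewrite /lapp lhomJ.
exists (mk_lhom gE); split; apply: lhomP => s.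
  by rewrite lsets_compE lsets_idE mk_lhomE; apply/f_inj/gK.
by rewrite lsets_compE lsets_idE mk_lhomE; apply: gK.
Qed.

(** * Elements of induced sets *)

Section InducedElements.
Variables (aT : finGroupType) (A B : {group aT}) (sBA : B \subset A).
Implicit Types (U : lset B) (T : lset A).

Lemma ind_tens_ind U (P : ind sBA U -> Prop) :
  (forall a u, a \in A -> P (ind_tens sBA a u)) -> forall t, P t.
Proof.
move=> Pt; elim/tensor_ind=> z u.
by rewrite -(sgvalK z); apply: Pt; apply: subgP.
Qed.

Lemma lact_ind_tens U a b (u : U) : a \in A -> b \in A ->
  lact a (ind_tens sBA b u) = ind_tens sBA (a * b) u.
Proof. by move=> Aa Ab; rewrite ltensorE //= -morphM. Qed.

Lemma ind_tens_bal U a b (u : U) : a \in A -> b \in B ->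
  ind_tens sBA (a * b) u = ind_tens sBA a (lact b u).
Proof.
move=> Aa Bb; rewrite /ind_tens -tens_bal //= -morphM //.
exact: (subsetP sBA).
Qed.

(** The group [a B a^-1] acts on [a (x) U] as on the conjugate of [U]. *)
Lemma ind_tens_conj U a b (u : U) : a \in A -> b \in (B :^ a^-1)%G ->
  ind_tens sBA a (lact (b ^ a) u) = lact b (ind_tens sBA a u).
Proof.
move=> Aa; rewrite mem_conjgV => Bba.
have Ab : b \in A by rewrite -(memJ_conjg _ a) conjGid // (subsetP sBA).
by rewrite -ind_tens_bal // lact_ind_tens // -conjgC.
Qed.

Lemma ind_tens_eq U a b (u v : U) : a \in A -> b \in A ->
  ind_tens sBA a u = ind_tens sBA b v ->
  exists2 c, c \in B & b = a * c^-1 /\ v = lact c u.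
Proof.
move=> Aa Ab /eqP/tens_eqP[c Bc [/= e ->]]; exists c => //; split=> //.
have Ac : c^-1 \in A by rewrite groupV (subsetP sBA).
by have := congr1 val e; rewrite /= !subgK // => ->.
Qed.

Lemma ind_functor_tens (U U' : lset B) (f : @hom (lsets B) U U') a (u : U) :
  lapp (fmap (ind_functor sBA) f) (ind_tens sBA a u) =
  ind_tens sBA a (lapp f u).
Proof.
exact: etrans (mk_lhomE (ind_fun_equivariant (sBA := sBA) f) _)
              (ind_funE f _ u).
Qed.

(** The map [a (x) u |-> a (f u)]; for a [B]-equivariant [f] it is well defined
    and is the morphism that corresponds to [f] under Frobenius reciprocity. *)
Definition ind_lift U T (f : U -> T) : ind sBA U -> T :=
  tensor_lift (fun (z : mul_biset sBA) u => lact (val z) (f u)).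

Lemma ind_liftE U T (f : U -> T) a u :
  {in B, forall b, {morph f : w / lact b w}} -> a \in A ->
  ind_lift f (ind_tens sBA a u) = lact a (f u).
Proof.
move=> fE Aa; rewrite /ind_lift tensor_liftE /= ?subgK // => b z w Bb.
have Ab : b \in A by apply: (subsetP sBA).
by rewrite subgK // lactM ?subgP // fE.
Qed.

Lemma ind_lift_equivariant U T (f : U -> T) :
  {in B, forall b, {morph f : w / lact b w}} ->
  {in A, forall a, {morph ind_lift f : t / lact a t}}.
Proof.
move=> fE a Aa; elim/ind_tens_ind=> b u Ab.
by rewrite lact_ind_tens // !ind_liftE ?groupM // lactM.
Qed.

End InducedElements.

(** * Elements of extended tensor products *)

Section ExtendedTensorElements.
Variables (gT hT kT : finGroupType).
Variables (X : {group gT * hT}) (Y : {group hT * kT}).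

Lemma linked_star p h : linked X Y p h -> p \in star X Y.
Proof. by move=> ph; rewrite inE; apply/existsP; exists h. Qed.

Lemma lact_ext_tens (U : lset X) (V : lset Y) p h (u : U) (v : V) :
  linked X Y p h ->
  @lact _ _ (ext U V) p (ext_tens u v) =
  ext_tens (lact (p.1, h) u) (lact (h, p.2) v).
Proof. exact: ext_actE. Qed.

Lemma ext_tens_eq (U : lset X) (V : lset Y) (u u' : U) (v v' : V) :
  ext_tens u v = ext_tens u' v' ->
  exists2 h, h \in kk X Y & u' = lact (1, h) u /\ v' = lact (h, 1) v.
Proof. by move/eqP/tens_eqP=> [h kh [/= -> ->]]; exists h; rewrite ?invgK. Qed.

Lemma ext_functor_tens (U U' : lset X) (V V' : lset Y)
    (f : @hom (lsets X) U U') (g : @hom (lsets Y) V V') (u : U) (v : V) :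
  lapp (@fmap _ _ (ext_functor X Y) (U, V) (U', V') (f, g)) (ext_tens u v) =
  ext_tens (lapp f u) (lapp g v).
Proof.
exact: etrans (mk_lhomE (ext_fun_equivariant f g) _) (ext_funE f g u v).
Qed.

End ExtendedTensorElements.

Lemma conj_functorE (aT : finGroupType) (A : {group aT}) x (U U' : lset A)
    (f : @hom (lsets A) U U') (u : U) :
  lapp (fmap (conj_functor A x) f) u = lapp f u.
Proof. exact: (mk_lhomE (lconj_equivariant (x := x) f)). Qed.

(** * Double coset representatives *)

Section DoubleCosets.
Variables (aT : finGroupType) (D E A : {group aT}) (R : {set aT}).
Hypothesis trR : is_transversal R (dcosets D E A) A.

Lemma mem_dcoset (z w : aT) :
  reflect (exists d e, [/\ d \in D, e \in E & w = d * z * e])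
          (w \in D * [set z] * E).
Proof.
apply: (iffP mulsgP) => [[b e /mulsgP[d c Dd /set1P-> ->] Ee ->] | ].
  by exists d, e.
case=> d [e [Dd Ee ->]]; exists (d * z) e => //.
by apply/mulsgP; exists d z => //; apply/set1P.
Qed.

Lemma dcoset_repr_ex a : a \in A ->
  exists r d e, [/\ r \in R, d \in D, e \in E & a = d * r * e].
Proof.
move=> Aa; have /and3P[_ _ /forall_inP trI] := trR.
have /cards1P[r /setP/(_ r)] := trI _ (imset_f (fun z => D * [set z] * E) Aa).
rewrite set11 => /setIP[Rr /mem_dcoset[d [e [Dd Ee def_r]]]].
exists r, d^-1, e^-1; split; rewrite ?groupV //.
by rewrite def_r !mulgA mulVg mul1g mulgK.
Qed.

Lemma dcoset_repr_uniq r s d e : r \in R -> s \in R ->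
  d \in D -> e \in E -> s = d * r * e -> r = s.
Proof.
move=> Rr Rs Dd Ee def_s; have /and3P[_ /subsetP sRA /forall_inP trI] := trR.
have /cards1P[z def_z] :=
  trI _ (imset_f (fun z => D * [set z] * E) (sRA r Rr)).
have: r \in R :&: (D * [set r] * E).
  by rewrite inE Rr; apply/mem_dcoset; exists 1, 1; rewrite !group1 mul1g mulg1.
have: s \in R :&: (D * [set r] * E).
  by rewrite inE Rs; apply/mem_dcoset; exists d, e.
by rewrite def_z => /set1P-> /set1P->.
Qed.

End DoubleCosets.

(** * The comparison map *)

Section Comparison.
Variables (gT hT kT : finGroupType).
Variables (X X' : {group gT * hT}) (Y Y' : {group hT * kT}).
Variables (sX : X' \subset X) (sY : Y' \subset Y).

Section Summand.
Variables (U : lset X') (V : lset Y') (x : gT * hT) (y : hT * kT).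
Hypotheses (Xx : x \in X) (Yy : y \in Y).

(** The map [u (x) v |-> (x (x) u) (x) (y (x) v)]. *)
Definition summand_unit :
    ext (lconj x U) (lconj y V) -> ext (ind sX U) (ind sY V) :=
  ext_lift (fun (u : lconj x U) (v : lconj y V) =>
    ext_tens (ind_tens sX x (u : U)) (ind_tens sY y (v : V))).

Lemma summand_unit_bal h (u : U) (v : V) :
  h \in kk (X' :^ x^-1)%G (Y' :^ y^-1)%G ->
  ext_tens (ind_tens sX x (lact ((1, h^-1) ^ x) u)) (ind_tens sY y v) =
  ext_tens (ind_tens sX x u) (ind_tens sY y (lact ((h, 1) ^ y) v)).
Proof.
rewrite in_setI !in_set => /andP[Xh Yh].
have sXx : X' :^ x^-1 \subset X by rewrite sub_conjg invgK conjGid.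
have sYy : Y' :^ y^-1 \subset Y by rewrite sub_conjg invgK conjGid.
have kh : h^-1 \in kk X Y.
  by rewrite groupV !inE (subsetP sXx) // (subsetP sYy).
rewrite (ind_tens_conj _ _ Xx) ?pair1V //.
rewrite (ind_tens_conj _ _ Yy) //.
by rewrite (ext_tens_bal (ind_tens sX x u) (ind_tens sY y v) kh) invgK.
Qed.

Lemma summand_unitE (u : lconj x U) (v : lconj y V) :
  summand_unit (ext_tens u v) =
  ext_tens (ind_tens sX x (u : U)) (ind_tens sY y (v : V)).
Proof. by apply: ext_liftE => h {}u {}v kh; apply: summand_unit_bal. Qed.

Lemma summand_unit_equivariant :
  {in star_group (X' :^ x^-1)%G (Y' :^ y^-1)%G,
     forall p, {morph summand_unit : t / lact p t}}.
Proof.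
move=> p /linkP pl; elim/ext_tens_ind=> u v.
have /andP[Xp Yp] := pl.
have pl' : linked X Y p (link (X' :^ x^-1)%G (Y' :^ y^-1)%G p).
  by apply/andP; split; [move: Xp | move: Yp]; apply: subsetP;
    rewrite /= sub_conjg invgK conjGid.
rewrite (lact_ext_tens u v pl) !summand_unitE.
rewrite (lact_ext_tens (ind_tens sX x (u : U)) (ind_tens sY y (v : V)) pl').
rewrite -(ind_tens_conj sX (u : U) Xx Xp).
by rewrite -(ind_tens_conj sY (v : V) Yy Yp).
Qed.

(** The extension [a (x) (u (x) v) |-> a ((x (x) u) (x) (y (x) v))] of
    [summand_unit] to the induced set. *)
Definition summand_fun :
    ind (star_conj_sub sX sY Xx Yy) (ext (lconj x U) (lconj y V)) ->
    ext (ind sX U) (ind sY V) :=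
  ind_lift summand_unit.

Lemma summand_funE a h u v : linked X Y a h ->
  summand_fun (@ind_tens _ _ _ _ (ext (lconj x U) (lconj y V)) a
    (@ext_tens _ _ _ _ _ (lconj x U) (lconj y V) u v)) =
  ext_tens (ind_tens sX ((a.1, h) * x) u) (ind_tens sY ((h, a.2) * y) v).
Proof.
move=> ah; have /andP[Xa Ya] := ah.
rewrite /summand_fun ind_liftE ?(linked_star ah) //; last first.
  exact: summand_unit_equivariant.
rewrite summand_unitE.
rewrite (lact_ext_tens (ind_tens sX x u) (ind_tens sY y v) ah).
by rewrite !lact_ind_tens.
Qed.

Lemma summand_fun_equivariant :
  {in star_group X Y, forall p, {morph summand_fun : t / lact p t}}.
Proof. exact/ind_lift_equivariant/summand_unit_equivariant. Qed.

End Summand.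

Variables (R : {set (gT * hT) * (hT * kT)}) (hR : dcoset_reprs X X' Y Y' R).

(** The element [a (x) (u (x) v)] of the summand indexed by [i], for [a] in
    [star X Y]. *)
Definition coprod_tens (U : lset X') (V : lset Y') (i : {p | p \in R}) a
    (u : U) (v : V) : (rhs_functor sX sY hR (U, V) : lset _) :=
  Tagged (fun i => summand_functor sX sY (repr_mem1 hR i) (repr_mem2 hR i)
                     (U, V) : lset _)
    (@ind_tens _ _ _ (star_conj_sub sX sY (repr_mem1 hR i) (repr_mem2 hR i))
      (ext (lconj (val i).1 U) (lconj (val i).2 V)) a
      (@ext_tens _ _ _ _ _ (lconj (val i).1 U) (lconj (val i).2 V) u v)).

Lemma coprod_tens_ind (U : lset X') (V : lset Y')
    (P : (rhs_functor sX sY hR (U, V) : lset _) -> Prop) :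
  (forall i a u v, a \in star X Y -> P (coprod_tens i a u v)) -> forall t, P t.
Proof.
move=> Pt [i]; elim/ind_tens_ind=> a s Aa.
by elim/ext_tens_ind: s => u v; apply: Pt.
Qed.

(** An element of the group from which the [i]-th summand is induced moves
    across the tensor sign, and it acts on [u] and [v] through conjugates. *)
Lemma coprod_tens_bal (U : lset X') (V : lset Y') (i : {p | p \in R}) a c h
    (u : U) (v : V) :
  a \in star X Y ->
  linked (X' :^ (val i).1^-1)%G (Y' :^ (val i).2^-1)%G c h ->
  coprod_tens i (a * c) u v =
  coprod_tens i a (lact ((c.1, h) ^ (val i).1) u)
                  (lact ((h, c.2) ^ (val i).2) v).
Proof.
move=> Aa cl; rewrite /coprod_tens ind_tens_bal ?(linked_star cl) //.
by rewrite (@lact_ext_tens _ _ _ _ _ (lconj (val i).1 U) (lconj (val i).2 V)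
              c h u v cl).
Qed.

(** The comparison map [a (x) (u (x) v) |-> a ((x (x) u) (x) (y (x) v))] out of
    the coproduct, with [(x, y)] the representative indexing the summand. *)
Definition mackey_fun (U : lset X') (V : lset Y')
    (s : (rhs_functor sX sY hR (U, V) : lset _)) : ext (ind sX U) (ind sY V) :=
  @summand_fun U V _ _ (repr_mem1 hR (tag s)) (repr_mem2 hR (tag s)) (tagged s).

Lemma mackey_funE (U : lset X') (V : lset Y') i a h u v : linked X Y a h ->
  mackey_fun (@coprod_tens U V i a u v) =
  ext_tens (ind_tens sX ((a.1, h) * (val i).1) u)
           (ind_tens sY ((h, a.2) * (val i).2) v).
Proof. exact: summand_funE. Qed.

Lemma mackey_fun_equivariant (U : lset X') (V : lset Y') :
  {in star_group X Y, forall p, {morph @mackey_fun U V : t / lact p t}}.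
Proof.
move=> p Ap [i s].
exact: (@summand_fun_equivariant U V _ _ (repr_mem1 hR i) (repr_mem2 hR i)).
Qed.

(** * Bijectivity of the comparison map *)

(** In a double coset decomposition in [setX X Y], the factor in the fibre
    product is a pair [((g, h), (h, k))]; it is given by the element
    [c = (g, k)] of [star X Y] and the element [h] linking its components. *)
Lemma fibre_dcoset_ex a b : a \in X -> b \in Y ->
  exists (i : {p | p \in R}) (c : gT * kT) h p q,
    [/\ linked X Y c h, p \in X', q \in Y',
        a = (c.1, h) * (val i).1 * p & b = (h, c.2) * (val i).2 * q].
Proof.
move=> Xa Yb; have Aab : (a, b) \in setX X Y by rewrite inE Xa.
have [[x y] [[[g h] [h' k]] [[p q] [Rxy]]]] := dcoset_repr_ex hR Aab.
rewrite !inE /= => /andP[/andP[Xd Yd] /eqP def_h'] /andP[X'p Y'q].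
rewrite -{h'}def_h' in Yd *; case=> -> ->.
exists (Sub (x, y) Rxy : {p | p \in R}), (g, k), h, p, q.
by split=> //; apply/andP.
Qed.

Lemma fibre_dcoset_uniq (i j : {p | p \in R}) c h p q :
  linked X Y c h -> p \in X' -> q \in Y' ->
  (val j).1 = (c.1, h) * (val i).1 * p ->
  (val j).2 = (h, c.2) * (val i).2 * q -> i = j.
Proof.
move=> /andP[Xc Yc] X'p Y'q ej1 ej2; apply: val_inj.
apply: (dcoset_repr_uniq hR (valP i) (valP j)
          (d := ((c.1, h), (h, c.2))) (e := (p, q))).
- by rewrite !inE Xc Yc /=.
- by rewrite !inE X'p.
by rewrite [LHS]surjective_pairing ej1 ej2.
Qed.

Lemma mackey_fun_surj (U : lset X') (V : lset Y')
    (t : ext (ind sX U) (ind sY V)) :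
  exists s, @mackey_fun U V s = t.
Proof.
elim/ext_tens_ind: t => s t.
elim/ind_tens_ind: s => a u Xa; elim/ind_tens_ind: t => b v Yb.
have [i [c [h [p [q [cl X'p Y'q -> ->]]]]]] := fibre_dcoset_ex Xa Yb.
have [[Xc Yc] [Xi Yi]] := (andP cl, (repr_mem1 hR i, repr_mem2 hR i)).
exists (coprod_tens i c (lact p u) (lact q v)).
by rewrite (mackey_funE _ _ _ cl) -!ind_tens_bal // groupM.
Qed.

(** If the images of two elements agree, then their representatives lie in the
    same double coset, and the two elements agree. *)
Lemma mackey_eq (U : lset X') (V : lset Y') i j a b (u u' : U) (v v' : V) :
  a \in star X Y -> b \in star X Y ->
  mackey_fun (coprod_tens i a u v) = mackey_fun (coprod_tens j b u' v') ->
  coprod_tens i a u v = coprod_tens j b u' v'.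
Proof.
move=> Aa Ab; have [al bl] := (linkP Aa, linkP Ab).
rewrite (mackey_funE _ _ _ al) (mackey_funE _ _ _ bl).
move: (link _ _ a) (link _ _ b) al bl => l m al bl.
have [[Xa Ya] [Xb Yb]] := (andP al, andP bl).
have [Xi Yi] := (repr_mem1 hR i, repr_mem2 hR i).
have [Xj Yj] := (repr_mem1 hR j, repr_mem2 hR j).
case/ext_tens_eq=> h; rewrite !inE => /andP[Xh Yh].
rewrite !lact_ind_tens ?groupM // => -[].
case/esym/ind_tens_eq; rewrite ?groupM // => p X'p [eX ->].
case/esym/ind_tens_eq; rewrite ?groupM // => q Y'q [eY ->].
(* The element c = b^-1 * a is linked by n, and eX and eY say that the
   representative j is obtained from i by multiplying with the element
   ((c.1, n), (n, c.2)) of the fibre product on the left and with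
   (p^-1, q^-1) on the right. *)
set n : hT := m^-1 * h * l.
have cn : linked X Y (b^-1 * a) n.
  apply/andP; split.
    have := groupM (groupM (groupVr Xb) Xh) Xa.
    by rewrite pairV !pairM mulg1.
  have := groupM (groupM (groupVr Yb) Yh) Ya.
  by rewrite pairV !pairM mulg1.
have ej1 : (val j).1 = ((b^-1 * a).1, n) * (val i).1 * p^-1.
  apply: (mulgI (b.1, m)); rewrite eX !mulgA; do 2 congr (_ * _).
  by rewrite !pairM /n /= mul1g !mulgA !mulgV !mul1g.
have ej2 : (val j).2 = (n, (b^-1 * a).2) * (val i).2 * q^-1.
  apply: (mulgI (m, b.2)); rewrite eY !mulgA; do 2 congr (_ * _).
  by rewrite !pairM /n /= mul1g !mulgA !mulgV !mul1g.
have eij : i = j.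
  by apply: fibre_dcoset_uniq cn _ _ ej1 ej2; rewrite groupV.
move: ej1 ej2; rewrite -{j}eij in Xj Yj eX eY * => ei1 ei2.
have def_p : p = ((b^-1 * a).1, n) ^ (val i).1.
  by apply: (mulIg p^-1); rewrite mulgV -mulgA -[in RHS]ei1 mulVg.
have def_q : q = (n, (b^-1 * a).2) ^ (val i).2.
  by apply: (mulIg q^-1); rewrite mulgV -mulgA -[in RHS]ei2 mulVg.
rewrite def_p def_q -coprod_tens_bal ?mulKVg //.
by rewrite /linked /= !mem_conjgV -def_p X'p -def_q.
Qed.

Lemma mackey_fun_inj (U : lset X') (V : lset Y') :
  injective (@mackey_fun U V).
Proof.
elim/coprod_tens_ind=> i a u v Aa; elim/coprod_tens_ind=> j b u' v' Ab.
exact: mackey_eq.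
Qed.

(** * Naturality *)

Lemma lhs_functor_tens (U U' : lset X') (V V' : lset Y')
    (f : @hom (lsets X') U U') (g : @hom (lsets Y') V V') x y (u : U) (v : V) :
  lapp (@fmap _ _ (lhs_functor sX sY) (U, V) (U', V') (f, g))
    (ext_tens (ind_tens sX x u) (ind_tens sY y v)) =
  ext_tens (ind_tens sX x (lapp f u)) (ind_tens sY y (lapp g v)).
Proof.
rewrite -(ind_functor_tens sX f x u) -(ind_functor_tens sY g y v).
exact: ext_functor_tens.
Qed.

Lemma summand_functor_tens (U U' : lset X') (V V' : lset Y')
    (f : @hom (lsets X') U U') (g : @hom (lsets Y') V V') x y
    (Xx : x \in X) (Yy : y \in Y) a (u : U) (v : V) :
  lapp (@fmap _ _ (summand_functor sX sY Xx Yy) (U, V) (U', V') (f, g))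
    (@ind_tens _ _ _ _ (ext (lconj x U) (lconj y V)) a
      (@ext_tens _ _ _ _ _ (lconj x U) (lconj y V) u v)) =
  @ind_tens _ _ _ _ (ext (lconj x U') (lconj y V')) a
    (@ext_tens _ _ _ _ _ (lconj x U') (lconj y V') (lapp f u) (lapp g v)).
Proof.
have Ec := congr2 (@ext_tens _ _ _ _ _ (lconj x U') (lconj y V'))
  (conj_functorE x f u) (conj_functorE y g v).
have Ee := ext_functor_tens (fmap (conj_functor X' x) f)
  (fmap (conj_functor Y' y) g) u v.
apply: etrans (congr1 (@ind_tens _ _ _ (star_conj_sub sX sY Xx Yy)
  (ext (lconj x U') (lconj y V')) a) (etrans Ee Ec)).
exact: ind_functor_tens.
Qed.

Lemma rhs_functor_tens (U U' : lset X') (V V' : lset Y')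
    (f : @hom (lsets X') U U') (g : @hom (lsets Y') V V')
    i a (u : U) (v : V) :
  lapp (@fmap _ _ (rhs_functor sX sY hR) (U, V) (U', V') (f, g))
    (coprod_tens i a u v) =
  coprod_tens i a (lapp f u) (lapp g v).
Proof.
rewrite /coprod_tens -summand_functor_tens.
exact: mk_lhomE.
Qed.

(** The comparison map as a morphism of left [star X Y]-sets, that is, the
    component at [(U, V)] of the natural isomorphism. *)
Definition mackey_hom (U : lset X') (V : lset Y') :
    lhom (rhs_functor sX sY hR (U, V) : lset _) (ext (ind sX U) (ind sY V)) :=
  mk_lhom (@mackey_fun_equivariant U V).

Lemma mackey_homE (U : lset X') (V : lset Y') s :
  mackey_hom U V s = mackey_fun s.
Proof. exact: mk_lhomE. Qed.

Definition mackey_component (a : prod_cat (lsets X') (lsets Y')) :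
    hom (rhs_functor sX sY hR a) (lhs_functor sX sY a) :=
  match a with (U, V) => mackey_hom U V end.

Lemma mackey_natural (a b : prod_cat (lsets X') (lsets Y')) (f : hom a b) :
  ccomp (mackey_component b) (fmap (rhs_functor sX sY hR) f) =
  ccomp (fmap (lhs_functor sX sY) f) (mackey_component a).
Proof.
case: a b f => [U V] [U' V'] [f g].
apply: lhomP; elim/coprod_tens_ind=> i c u v /linkP cl.
pose Lfg := @fmap _ _ (lhs_functor sX sY) (U, V) (U', V') (f, g).
apply: etrans (lsets_compE _ _ _) (etrans _ (esym (lsets_compE _ _ _))).
transitivity (mackey_fun (coprod_tens i c (lapp f u) (lapp g v))).
  exact: etrans (congr1 (mackey_hom U' V') (rhs_functor_tens f g i c u v))
                (mackey_homE _).
transitivity (lapp Lfg (mackey_fun (coprod_tens i c u v))); last first.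
  have E := congr1 (lapp Lfg) (esym (mackey_homE (coprod_tens i c u v))).
  exact: E.
rewrite !(mackey_funE _ _ _ cl); exact/esym/lhs_functor_tens.
Qed.

Definition mackey_nat_trans :
    nat_trans (rhs_functor sX sY hR) (lhs_functor sX sY) :=
  NatTrans mackey_natural.

End Comparison.

Theorem theorem2p10 (gT hT kT : finGroupType)
    (X X' : {group gT * hT}) (Y Y' : {group hT * kT})
    (sX : X' \subset X) (sY : Y' \subset Y)
    (R : {set (gT * hT) * (hT * kT)}) (hR : dcoset_reprs X X' Y Y' R) :
  exists theta : nat_trans (rhs_functor sX sY hR) (lhs_functor sX sY),
    is_nat_iso theta /\
    forall (U : lset X') (V : lset Y') (i : {p | p \in R}) (u : U) (v : V),
      lapp (theta (U, V)) (rhs_elt sX sY hR i u v) =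
      ext_tens (ind_tens sX (val i).1 u) (ind_tens sY (val i).2 v).
Proof.
exists (mackey_nat_trans sX sY hR); split=> [[U V] | U V i u v].
  apply: bij_is_iso => [s t e | t].
    have e' := etrans (esym (mackey_homE s)) (etrans e (mackey_homE t)).
    exact: mackey_fun_inj e'.
  have [s es] := mackey_fun_surj hR t.
  by exists s; apply: etrans (mackey_homE s) es.
have E := mackey_homE (coprod_tens sX sY hR i 1 u v).
by rewrite (mackey_funE sX sY hR i u v (linked1 X Y)) !mul1g in E; exact: E.
Qed.
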